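(* There exist a group $G$ and a finite generating set $A$ of $G$ such that the language of all geodesic words in $A^*$ is a regular language, but $A$ does not have the falsification by fellow traveler property.
   Context: Let $G$ be a group. A finite generating set $A\subseteq G$ means a finite subset such that every element of $G$ is represented by some word in $A^*$, the set of all finite strings (including the empty string) over $A$ (i.e. $A$ generates $G$ as a monoid). A word in $A^*$ represents a path in the Cayley graph of $G$ with respect to $A$ based at any vertex (the edges go from $g$ to $ga$, $a\in A$). Let $d$ denote the path metric on the Cayley graph, each edge having length $1$. A word $w\in A^*$ is geodesic if no shorter word in $A^*$ represents the same element of $G$. A language $L\subseteq A^*$ is regular if it is the set of words accepted by a finite state automaton over $A$ (finite set of states, transition map $\tau:S\times A\to S$, a start state, and a subset of accept states). For a path $w$, and real $t\ge 0$, let $w(t)$ be the point at distance $t$ along the path $w$ if $t$ is between $0$ and the length of $w$, and the endpoint of $w$ otherwise. For a real constant $k$, paths $u$ and $v$ are said to $k$-fellow travel if $d(u(t),v(t))\le k$ for all real $t\ge 0$. The generating set $A$ has the falsification by fellow traveler property if there is a constant $k$ such that for every non-geodesic word $w\in A^*$ there is a word $v\in A^*$, strictly shorter than $w$ and representing the same element of $G$ as $w$, such that the paths $w$ and $v$ based at the same vertex $k$-fellow travel. *)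

(* Defs.v *)
From mathcomp Require Import all_boot all_order all_algebra finmap.
From mathcomp Require Import all_classical all_reals ereal.

Set Implicit Arguments.
Unset Strict Implicit.
Unset Printing Implicit Defensive.

Import Order.TTheory GRing.Theory Num.Theory.

Local Open Scope classical_set_scope.
Local Open Scope ring_scope.

Section Words.
Context {G : groupType} {A : {fset G}}.

Definition word_eval (w : seq A) : G := \big[*%g/1%g]_(a <- w) val a.

Definition geodesic (w : seq A) : Prop :=
  forall v : seq A, word_eval v = word_eval w -> (size w <= size v)%N.

End Words.

(* Generation is as a monoid: inverses of elements of A are not used. *)
Definition generating (G : groupType) (A : {fset G}) : Prop :=
  forall g : G, exists w : seq A, word_eval w = g.

Record dfa (A : finType) := DFA {
  dfa_state : finType;
  dfa_trans : dfa_state -> A -> dfa_state;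
  dfa_start : dfa_state;
  dfa_accept : {set dfa_state}
}.

Definition dfa_accepts (A : finType) (M : dfa A) (w : seq A) : bool :=
  foldl (@dfa_trans A M) (dfa_start M) w \in dfa_accept M.

Definition regular (A : finType) (L : set (seq A)) : Prop :=
  exists M : dfa A, L = [set w | dfa_accepts M w].

Section CayleyGraph.
Context {R : realType} {G : groupType} {A : {fset G}}.

(* Representatives of the points of the metric Cayley graph: [OnEdge g a s],
   for 0 <= s <= 1, is the point at distance s from g on the edge from g to
   g * a. The identification of the ends of an edge with vertices is made by
   the zero-length steps [gr_source] and [gr_target] below. *)
Inductive cayley_point :=
  | Vertex of G
  | OnEdge of G & A & R.

(* [graph_route p q l]: p and q are joined by a route of length l, made of
   finitely many segments of edges, traversed in either direction. *)
Inductive graph_route : cayley_point -> cayley_point -> R -> Prop :=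
  | gr_refl p : graph_route p p 0
  | gr_segment g a s s' : 0 <= s <= 1 -> 0 <= s' <= 1 ->
      graph_route (OnEdge g a s) (OnEdge g a s') `|s - s'|
  | gr_source g a : graph_route (Vertex g) (OnEdge g a 0) 0
  | gr_target g a : graph_route (OnEdge g a 1) (Vertex (g * val a)%g) 0
  | gr_sym p q l : graph_route p q l -> graph_route q p l
  | gr_trans p q r l m :
      graph_route p q l -> graph_route q r m -> graph_route p r (l + m).

(* The path metric; +oo if the points are not connected, which does not happen
   when A generates G. *)
Definition cayley_dist (p q : cayley_point) : \bar R :=
  ereal_inf [set l%:E | l in graph_route p q].

(* For t >= 0, the point w(t) of the path labelled w that starts at g. *)
Fixpoint path_point (g : G) (w : seq A) (t : R) : cayley_point :=
  if w is a :: w' then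
    if t < 1 then OnEdge g a t else path_point (g * val a)%g w' (t - 1)
  else Vertex g.

Definition fellow_travel (k : R) (p q : R -> cayley_point) : Prop :=
  forall t : R, 0 <= t -> (cayley_dist (p t) (q t) <= k%:E)%E.

End CayleyGraph.

(* Falsification by fellow traveler property. *)
Definition FFTP (R : realType) (G : groupType) (A : {fset G}) : Prop :=
  exists k : R, forall w : seq A, ~ geodesic w ->
    exists v : seq A,
      [/\ (size v < size w)%N,
          word_eval v = word_eval w &
          forall g : G, fellow_travel k (path_point g w) (path_point g v)].

(* Main.v *)
Require Import Defs.
From HB Require Import structures.
From mathcomp Require Import all_boot all_order all_algebra finmap.
From mathcomp Require Import all_classical all_reals.
From mathcomp Require Import ereal zify.

(** The example is Cannon's: the wreath product of Z by Z/2 with the generators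
  t (the swap) and a, a^-1 (translations of the first coordinate). Every
  element of (Z x Z) t has a representative a^x t a^y, and every element of
  Z x Z a representative a^x t a^y t (or a^x if y = 0), which gives the word
  length in closed form. Whether a letter increases the length of an element
  depends only on the signs of its two coordinates and on the presence of t,
  so these data are the states of an automaton recognising geodesics.
  On the other hand w = t a^m t a^m t is not geodesic, but it first travels
  along the second axis, and a strictly shorter word with the same value must
  first travel along the first axis, like a^m t a^m. *)

Local Open Scope classical_set_scope.

Import Order.TTheory GRing.Theory Num.Theory.

(** * Lower bounds for distances in the metric Cayley graph *)

Section LipschitzFunctions.
Local Open Scope ring_scope.
Context {R : realType} {G : groupType} {A : {fset G}}.
Variable phi : G -> R.

Definition edge_extension (p : @cayley_point R G A) : R :=
  match p with
  | Vertex g => phi g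
  | OnEdge g a s => phi g + s * (phi (g * val a)%g - phi g)
  end.

(** At an integer time before the end of [v] the point is some [OnEdge _ _ 0] and not a [Vertex];
    the extension does not see the difference. Past the end, [take] returns all of [v], in
    accordance with the path resting at its endpoint. *)
Lemma edge_extension_path_point (g : G) (v : seq A) (n : nat) :
  edge_extension (path_point g v n%:R) = phi (g * word_eval (take n v))%g.
Proof.
elim: v g n => [|a v IH] g [|n] /=; rewrite /word_eval ?big_nil ?mulg1 //=.
- by rewrite ltr01 /= mul0r addr0.
- by rewrite ltNge ler1n /= big_cons mulgA -IH -natr1 addrK.
Qed.

Hypothesis phi_lipschitz :
  forall (g : G) (a : A), `|phi (g * val a)%g - phi g| <= 1.

(** The extension is affine on each edge with slope at most 1 in absolute value, and the bounds on
    segments add up along a route. *)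
Lemma edge_extension_route (p q : @cayley_point R G A) (l : R) :
  graph_route p q l -> `|edge_extension p - edge_extension q| <= l.
Proof.
elim=> {p q l} /=.
- by move=> p; rewrite subrr normr0.
- move=> g a s s' _ _; rewrite opprD addrACA subrr add0r -mulrBl normrM.
  exact: ler_piMr (normr_ge0 _) (phi_lipschitz g a).
- by move=> g a; rewrite mul0r addr0 subrr normr0.
- by move=> g a; rewrite mul1r subrKC subrr normr0.
- by move=> p q l _; rewrite distrC.
- move=> p q r l m _ IHl _ IHm.
  exact: le_trans (ler_distD (edge_extension q) _ _) (lerD IHl IHm).
Qed.

Lemma edge_extension_dist (p q : @cayley_point R G A) :
  (`|edge_extension p - edge_extension q|%:E <= cayley_dist p q)%E.
Proof.
apply: le_ereal_inf_tmp => _ [l route_l <-].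
by rewrite lee_fin edge_extension_route.
Qed.

End LipschitzFunctions.

Lemma word_eval_cat (G : groupType) (A : {fset G}) (u v : seq A) :
  word_eval (u ++ v) = (word_eval u * word_eval v)%g.
Proof. exact: big_cat. Qed.

Lemma word_eval_rcons (G : groupType) (A : {fset G}) (w : seq A) (a : A) :
  word_eval (rcons w a) = (word_eval w * val a)%g.
Proof. by rewrite -cats1 word_eval_cat /word_eval big_seq1. Qed.

(** * The wreath product and its generators *)

Section WreathProduct.
Local Open Scope ring_scope.

(* [(x, y, e)] stands for the element (x, y) t^e of the wreath product. *)
Definition wreath : Type := (int * int * bool)%type.
HB.instance Definition _ := Choice.on wreath.

(** Moving [t] past a pair exchanges its coordinates, so right multiplication by [shift b] acts on
    the first coordinate if [e] is false and on the second if [e] is true. *)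
Definition wreath_mul (g h : wreath) : wreath :=
  let: (x, y, e) := g in let: (x', y', e') := h in
  if e then (x + y', y + x', ~~ e') else (x + x', y + y', e').

Definition wreath_inv (g : wreath) : wreath :=
  let: (x, y, e) := g in if e then (- y, - x, e) else (- x, - y, e).

Lemma wreath_mulA : associative wreath_mul.
Proof. by move=> [[x y] []] [[x' y'] []] [[x'' y''] e] /=; rewrite !addrA ?negbK. Qed.

Lemma wreath_mul1g : left_id (0, 0, false) wreath_mul.
Proof. by move=> [[x y] e] /=; rewrite !add0r. Qed.

Lemma wreath_mulg1 : right_id (0, 0, false) wreath_mul.
Proof. by move=> [[x y] []] /=; rewrite !addr0. Qed.

Lemma wreath_mulVg : left_inverse (0, 0, false) wreath_inv wreath_mul.
Proof. by move=> [[x y] []] /=; rewrite !addNr. Qed.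

Lemma wreath_mulgV : right_inverse (0, 0, false) wreath_inv wreath_mul.
Proof. by move=> [[x y] []] /=; rewrite !subrr. Qed.

HB.instance Definition _ := isGroup.Build wreath
  wreath_mulA wreath_mul1g wreath_mulg1 wreath_mulVg wreath_mulgV.

Lemma wreath_mulE (g h : wreath) : (g * h)%g = wreath_mul g h.
Proof. by []. Qed.

Definition swap : wreath := (0, 0, true).
Definition shift (b : bool) : wreath := ((if b then 1 else -1), 0, false).

Definition cannon_gens : {fset wreath} :=
  [fset swap; shift true; shift false]%fset.

Lemma swap_in : swap \in cannon_gens.
Proof. by rewrite !inE eqxx. Qed.

Lemma shift_in (b : bool) : shift b \in cannon_gens.
Proof. by case: b; rewrite !inE eqxx ?orbT. Qed.

Definition swap_gen : cannon_gens := [` swap_in]%fset.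
Definition shift_gen (b : bool) : cannon_gens := [` shift_in b]%fset.

Lemma cannon_gensP (c : cannon_gens) :
  val c = swap \/ exists b, val c = shift b.
Proof.
case: c => c /=; rewrite !inE -orbA => /or3P[] /eqP ->; first by left.
- by right; exists true.
- by right; exists false.
Qed.

(** * Word length in closed form *)

(** The terms beyond the absolute values count letters [t]: their parity is given by [e], and to
    reach a nonzero [y] with [e] false takes two. *)
Definition wreath_length (g : wreath) : nat :=
  let: (x, y, e) := g in
  if e then (absz x + absz y).+1
  else if y == 0 then absz x else (absz x + absz y).+2.

Lemma wreath_length_mul_gen (g : wreath) (c : cannon_gens) :
  (wreath_length (g * val c)%g <= (wreath_length g).+1)%N.
Proof.
rewrite wreath_mulE; case: g => [[x y] e].
case: (cannon_gensP c) => [->|[[] ->]]; case: e => /=; rewrite ?addr0;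
  try case: eqP => ?; lia.
Qed.

Lemma wreath_length_le (w : seq cannon_gens) :
  (wreath_length (word_eval w) <= size w)%N.
Proof.
elim/last_ind: w => [|w c IH]; first by rewrite /word_eval big_nil.
rewrite word_eval_rcons size_rcons.
by apply: leq_trans (wreath_length_mul_gen _ c) _; rewrite ltnS.
Qed.

Definition shift_word (x : int) : seq cannon_gens :=
  nseq (absz x) (shift_gen (0 <= x)).

Lemma word_eval_shift_word (x : int) : word_eval (shift_word x) = (x, 0, false).
Proof.
have nseqE b n : word_eval (nseq n (shift_gen b)) =
    ((if b then n%:Z else - n%:Z), 0, false) :> wreath.
  elim: n => [|n IH]; first by rewrite /word_eval big_nil; case: b.
  rewrite -[n.+1]addn1 nseqD cats1 word_eval_rcons IH wreath_mulE /=.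
  by case: b {IH}; congr (_, _, _); lia.
by rewrite nseqE; congr (_, _, _); case: ifP; lia.
Qed.

Lemma word_eval_swap_cons (w : seq cannon_gens) :
  word_eval (swap_gen :: w) = (swap * word_eval w)%g.
Proof. exact: big_cons. Qed.

Lemma wreath_length_attained (g : wreath) :
  exists w : seq cannon_gens, word_eval w = g /\ size w = wreath_length g.
Proof.
case: g => [[x y] []] /=; last case: eqP => [->|_].
- exists (shift_word x ++ swap_gen :: shift_word y).
  rewrite word_eval_cat word_eval_swap_cons !word_eval_shift_word !wreath_mulE.
  by rewrite size_cat /= !size_nseq !addr0 !add0r; split; last lia.
- by exists (shift_word x); rewrite word_eval_shift_word size_nseq.
- exists (shift_word x ++ swap_gen :: rcons (shift_word y) swap_gen).
  rewrite word_eval_cat word_eval_swap_cons word_eval_rcons.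
  rewrite !word_eval_shift_word !wreath_mulE.
  rewrite size_cat /= size_rcons !size_nseq !addr0 !add0r.
  by split; last lia.
Qed.

Lemma geodesicE (w : seq cannon_gens) :
  geodesic w <-> wreath_length (word_eval w) = size w.
Proof.
split=> [geo_w | len_w v eq_vw]; last by rewrite -len_w -eq_vw wreath_length_le.
have [v [eq_vw size_v]] := wreath_length_attained (word_eval w).
by apply/eqP; rewrite eqn_leq wreath_length_le -size_v geo_w.
Qed.

Lemma generating_cannon_gens : generating cannon_gens.
Proof. by move=> g; have [w [? _]] := wreath_length_attained g; exists w. Qed.

(** * The automaton of geodesics *)

Definition sign (x : int) : option bool := if x == 0 then None else Some (0 < x).

Definition cone_type (g : wreath) : option bool * option bool * bool :=
  let: (x, y, e) := g in (sign x, sign y, e).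

(* [None] is the failure state, reached once a letter does not increase the
   length. *)
Definition cone_step (s : option (option bool * option bool * bool))
    (c : cannon_gens) : option (option bool * option bool * bool) :=
  if s is Some (p, q, e) then
    let: (z, _, swaps) := val c in
    let b := 0 < z in
    if swaps then if e == (q == None) then None else Some (p, q, ~~ e)
    else if e then if q == Some (~~ b) then None else Some (p, Some b, e)
    else if p == Some (~~ b) then None else Some (Some b, q, e)
  else None.

(** A unit step shortens a coordinate of opposite sign; otherwise it lands on a nonzero coordinate
    with the sign of the step. So the sign alone can be updated as long as lengths grow. *)
Lemma sign_shift (x : int) (b : bool) :
  let x' := x + (if b then 1 else -1) in
  if sign x == Some (~~ b) then (absz x' == (absz x).+1) = false
  else absz x' = (absz x).+1 /\ sign x' = Some b.
Proof.
rewrite /sign /=; case: (x =P 0) => [->|x_neq0] /=; first by case: b.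
case: ltP => x_sign; case: b; rewrite ?eqxx /=.
- split; first lia.
  by rewrite (_ : _ == 0 = false); [congr Some|]; lia.
- lia.
- lia.
- split; first lia.
  by rewrite (_ : _ == 0 = false); [congr Some|]; lia.
Qed.

Lemma cone_stepE (g : wreath) (c : cannon_gens) :
  cone_step (Some (cone_type g)) c =
  if wreath_length (g * val c)%g == (wreath_length g).+1
  then Some (cone_type (g * val c)%g) else None.
Proof.
rewrite wreath_mulE; case: g => [[x y] e]; rewrite /cone_step /=.
case: (cannon_gensP c) => [->|[b ->]] /=; last first.
  have -> : (0 < (if b then 1 else -1) :> int) = b by case: b.
  case: e => /=; rewrite addr0.
  - case: (sign y == _) (sign_shift y b) => /= [len_y|[-> ->]].
      by rewrite eqSS -addnS eqn_add2l len_y.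
    by rewrite addnS eqxx.
  - case: (sign x == _) (sign_shift x b) => /= [len_x|[-> ->]].
      by case: (y == 0); rewrite ?len_x // !eqSS -addSn eqn_add2r len_x.
    by case: (y == 0); rewrite ?addSn eqxx.
(* For the letter [t]: it cancels the last [t] of the normal form exactly when [e] holds with
   [y = 0] or fails with [y <> 0]. *)
have sign_eqN : (sign y == None) = (y == 0) by rewrite /sign; case: (y == 0).
by case: e => /=; rewrite !addr0 sign_eqN; case: (y =P 0) => [->|_] /=;
  rewrite ?addn0 ?eqxx //; case: eqP => //; lia.
Qed.

Lemma regular_geodesic_cannon_gens :
  regular [set w : seq cannon_gens | geodesic w].
Proof.
exists (DFA cone_step (Some (cone_type 1%g)) [set~ None]).
have runE (w : seq cannon_gens) : foldl cone_step (Some (cone_type 1%g)) w =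
    if wreath_length (word_eval w) == size w
    then Some (cone_type (word_eval w)) else None.
  elim/last_ind: w => [|w c IH]; first by rewrite /word_eval big_nil.
  rewrite foldl_rcons IH word_eval_rcons size_rcons.
  case: eqP => [<-|len_w]; first exact: cone_stepE.
  (* A letter adds at most one to the length, so a deficit is never made up and the failure state
     may be absorbing. *)
  case: eqP => // len_wc.
  have := wreath_length_mul_gen (word_eval w) c.
  have := wreath_length_le w; rewrite len_wc; lia.
apply/seteqP; split=> w /=; rewrite /dfa_accepts /= !inE runE.
- by move/geodesicE => ->; rewrite eqxx.
- by case: ifP => // /eqP /geodesicE.
Qed.

(** * Failure of the fellow traveler property *)

(* [g] and [h] are the values of the first [m] letters and of the rest of a word
   shorter than [t a^m t a^m t]. *)
Lemma prefix_second_coordinate (m : nat) (g h : wreath) :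
  (g * h)%g = (m%:Z, m%:Z, true) -> (wreath_length g <= m)%N ->
  (wreath_length h <= m.+2)%N -> g.1.2 <= 0.
Proof.
case: g h => [[x y] e] [[x' y'] e']; rewrite wreath_mulE.
(* The length bounds add up to [2m + 2], and the four absolute values to at least [2m], so three
   letters [t] are too many. This excludes [e] with [y' <> 0], and [y <> 0] without [e]; [e] with
   [y' = 0] would give [x = m], too long for [g]. *)
case: e; case: e' => //= -[? ?]; case: eqP => ?; lia.
Qed.

Lemma not_FFTP_cannon_gens (R : realType) : ~ FFTP R cannon_gens.
Proof.
case=> k fftp.
have [n k_lt_n] : exists n : nat, k < n%:R.
  by exists (Num.bound `|k|); apply: le_lt_trans (ler_norm k) (archi_boundP _).
(* The first [m] letters of [w] are then one [t] and [n] shifts, which bring the second coordinate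
   to [n > k]. *)
pose m := n.+1.
pose w := swap_gen :: shift_word m ++ swap_gen :: rcons (shift_word m) swap_gen.
have eval_w : word_eval w = (m%:Z, m%:Z, true).
  rewrite word_eval_swap_cons word_eval_cat word_eval_swap_cons word_eval_rcons.
  by rewrite !word_eval_shift_word !wreath_mulE /= !addr0 !add0r.
have size_w : size w = (m + m + 3)%N.
  by rewrite /= size_cat /= size_rcons !size_nseq; lia.
have [|v [size_v eval_v travel]] := fftp w.
  by move/geodesicE; rewrite eval_w size_w /=; lia.
pose phi (g : wreath) : R := g.1.2%:~R.
have phi_lipschitz (g : wreath) (a : cannon_gens) :
    `|phi (g * val a)%g - phi g| <= 1.
  rewrite /phi -intrB -intr_norm lerz1 wreath_mulE.
  case: g => [[x y] e].
  case: (cannon_gensP a) => [->|[b ->]]; case: e => /=; try case: b; lia.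
have := travel 1%g m%:R (ler0n _ _); apply/negP; rewrite -ltNge.
apply: lt_le_trans (edge_extension_dist _ phi_lipschitz _ _).
rewrite lte_fin !edge_extension_path_point !mul1g.
have take_w : take m w = swap_gen :: shift_word n.
  rewrite -[take m w]/(swap_gen :: take n (shift_word m ++ _)).
  by rewrite takel_cat ?size_nseq // take_nseq.
have -> : word_eval (take m w) = (0, n%:Z, true).
  by rewrite take_w word_eval_swap_cons word_eval_shift_word wreath_mulE /= !add0r.
apply: lt_le_trans (ler_norm _); apply: lt_le_trans k_lt_n _.
rewrite /phi -intrB -[n%:R]/(n%:Z%:~R) ler_int /=.
suff : (word_eval (take m v)).1.2 <= 0 by lia.
apply: (@prefix_second_coordinate m _ (word_eval (drop m v))).
- by rewrite -word_eval_cat cat_take_drop eval_v.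
- by apply: leq_trans (wreath_length_le _) _; rewrite size_take_min geq_minl.
- apply: leq_trans (wreath_length_le _) _; rewrite size_drop leq_subLR -ltnS.
  by apply: leq_trans size_v _; rewrite size_w; lia.
Qed.

End WreathProduct.

Theorem theorem3p5 (R : realType) :
  exists (G : groupType) (A : {fset G}),
    [/\ generating A,
        regular [set w : seq A | geodesic w] &
        ~ FFTP R A].
Proof.
exists wreath, cannon_gens; split.
- exact: generating_cannon_gens.
- exact: regular_geodesic_cannon_gens.
- exact: not_FFTP_cannon_gens.
Qed.
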